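(* Let $d \in \mathbb{N}$, let $S \in \mathcal{S}^d(1)$, and let $i \in \{1, \ldots, d+1\}$. Let $\beta_1 \ge \beta_2 \ge \cdots \ge \beta_{d+1}$ be the barycentric coordinates of the unique interior integral point of $S$ with respect to the vertices of $S$, ordered decreasingly. Then \[ \beta_i \ge \frac{1}{(d-i+2)(s_i - 1)}. \] Moreover: (a) If $S$ is unimodularly equivalent to $T^d_{1,i}$, then equality holds. (b) Equality holds if and only if \[ (\beta_1, \ldots, \beta_{d+1}) = \Big(\tfrac{1}{s_1}, \ldots, \tfrac{1}{s_{i-1}}, \tfrac{1}{(d-i+2)(s_i-1)}, \ldots, \tfrac{1}{(d-i+2)(s_i-1)}\Big). \] (c) For $i = d+1$, equality holds if and only if $S$ is unimodularly equivalent to $T^d_{1,d+1} = \operatorname{conv}(\{0, s_1 e_1, \ldots, s_d e_d\})$.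
   Context: The Sylvester sequence is defined by $s_1 = 2$ and $s_i = \prod_{j=1}^{i-1} s_j + 1$ for $i \ge 2$ (so $s_2=3, s_3=7, s_4=43,\dots$). For $k \ge 0$, $\mathcal{P}^d(k)$ denotes the set of $d$-dimensional polytopes $P \subseteq \mathbb{R}^d$ with all vertices in $\mathbb{Z}^d$ and exactly $k$ integral points in their interior, and $\mathcal{S}^d(k)$ is the set of simplices in $\mathcal{P}^d(k)$. Two integral polytopes $P,Q$ are unimodularly equivalent if there is an affine bijection $\phi$ of $\mathbb{R}^d$ with $\phi(\mathbb{Z}^d)=\mathbb{Z}^d$ and $\phi(P)=Q$. For a $d$-simplex with vertices $v_1,\dots,v_{d+1}$, the barycentric coordinates of $x$ are the unique reals $\beta_1,\dots,\beta_{d+1}$ with $\sum \beta_i = 1$ and $x=\sum \beta_i v_i$. For $j \in \{1,\ldots,d+1\}$, $T^d_{1,j} := \operatorname{conv}(\{0, s_1 e_1, \ldots, s_{j-1} e_{j-1}, (d-j+2)(s_j-1)e_j, \ldots, (d-j+2)(s_j-1) e_d\})$ (so $T^d_{1,1} = \operatorname{conv}(\{0,(d+1)e_1,\ldots,(d+1)e_d\})$ and $T^d_{1,d+1}=\operatorname{conv}(\{0,s_1e_1,\ldots,s_de_d\})$), where $e_i$ are the standard unit vectors. *)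

(* Defs.v *)
From HB Require Import structures.
From mathcomp Require Import all_boot all_order all_algebra all_fingroup.
Set Implicit Arguments. Unset Strict Implicit. Unset Printing Implicit Defensive.
Import Order.TTheory GRing.Theory Num.Theory.
Local Open Scope ring_scope.

(* Sylvester sequence: sylvprod k = s_1 * ... * s_k, sylv i = s_i (i >= 1). *)
Fixpoint sylvprod (k : nat) : nat :=
  if k is k'.+1 then (sylvprod k' * (sylvprod k').+1)%N else 1%N.
Definition sylv (i : nat) : nat := (sylvprod i.-1).+1.

Lemma sylv_small : [/\ sylv 1 = 2%N, sylv 2 = 3%N, sylv 3 = 7%N & sylv 4 = 43%N].
Proof. by []. Qed.

Section Geometry.
Variable R : realFieldType.

Definition intpt (d : nat) (x : 'rV[R]_d) : Prop :=
  exists z : 'rV[int]_d, x = map_mx (fun t : int => t%:~R) z.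

Definition rmx (m d : nat) (V : 'M[int]_(m, d)) : 'M[R]_(m, d) :=
  map_mx (fun t : int => t%:~R) V.

Definition conv (m d : nat) (V : 'M[R]_(m, d)) (x : 'rV[R]_d) : Prop :=
  exists lam : 'I_m -> R, (forall k, 0 <= lam k) /\ \sum_k lam k = 1 /\
    x = \sum_k lam k *: row k V.

Definition interior (d : nat) (P : 'rV[R]_d -> Prop) (x : 'rV[R]_d) : Prop :=
  exists2 e : R, 0 < e &
    forall y : 'rV[R]_d, (forall j, `|y 0 j - x 0 j| < e) -> P y.

Definition aff_indep (m d : nat) (V : 'M[R]_(m, d)) : Prop :=
  forall lam : 'I_m -> R, \sum_k lam k = 0 -> \sum_k lam k *: row k V = 0 ->
    forall k, lam k = 0.

Definition is_bary (m d : nat) (V : 'M[R]_(m, d)) (x : 'rV[R]_d)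
    (beta : 'I_m -> R) : Prop :=
  \sum_k beta k = 1 /\ x = \sum_k beta k *: row k V.

Definition in_Sd1 (d : nat) (V : 'M[int]_(d.+1, d)) : Prop :=
  aff_indep (rmx V) /\
  exists! x : 'rV[R]_d, intpt x /\ interior (conv (rmx V)) x.

Definition unimod_equiv (d : nat) (P Q : 'rV[R]_d -> Prop) : Prop :=
  exists (A : 'M[R]_d) (b : 'rV[R]_d),
    A \in unitmx /\
    (forall y, intpt y <-> exists2 x, intpt x & x *m A + b = y) /\
    (forall y, Q y <-> exists2 x, P x & x *m A + b = y).

End Geometry.

(* Vertex matrix of T^d_{1,j} (j 1-based, 1 <= j <= d+1): row 0 is the origin,
   row k (1 <= k <= d) is c_k e_k with c_k = s_k if k < j and
   c_k = (d-j+2)(s_j - 1) otherwise. *)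
Definition Tcoef (d j k : nat) : nat :=
  if (k < j)%N then sylv k else ((d.+2 - j) * (sylv j - 1))%N.

Definition Tmat (d j : nat) : 'M[int]_(d.+1, d) :=
  \matrix_(r < d.+1, c < d) if r == c.+1 :> nat then (Tcoef d j c.+1)%:Z else 0.

(* Main.v *)
Require Import Defs.
From HB Require Import structures.
From mathcomp Require Import all_boot all_order all_algebra all_fingroup.
From mathcomp Require Import ring lra zify.
Import Order.TTheory GRing.Theory Num.Theory.
Local Open Scope ring_scope.

(** Since x is the only interior lattice point, the lattice points
    (N + 1) x - sum_k n_k v_k (N = sum_k n_k >= 0) have a nonpositive barycentric
    coordinate unless they equal x.  A pigeonhole argument in a box whose sides
    are the coordinates beta_k = p_k / q, k in A, turns this into the product-sum
    inequality prod_(k in A) beta_k <= sum_(k notin A) beta_k for every proper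
    subset A of the vertices.  Applied to the j largest coordinates, it forces
    beta_1 + ... + beta_j <= 1/s_1 + ... + 1/s_j = 1 - 1/(s_1 ... s_j), with
    equality only for beta_l = 1/s_l: at a first failure the beta_l would be
    majorized by the 1/s_l, and AM-GM with Abel summation gives
    prod beta_l >= prod 1/s_l, contradicting the product-sum inequality.  The
    bound follows from (d - i + 2) beta_i >= beta_i + ... + beta_(d+1).

    In the extremal case i = d + 1, pairwise coprimality of the s_l shows that
    the edges at the last vertex are s_l f_l with f_l integral; an integral point
    that is not an integral combination of the f_l would yield, after reduction
    of its f-coordinates modulo 1, a second interior lattice point. *)

(** * Majorization: Abel summation and AM-GM *)

Section Majorization.
Variable F : realFieldType.
Implicit Types (x a : nat -> F).

(** Abel summation of the terms (a_l - x_l) / x_l: the partial sums [D] are nonnegative before n and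
    the weights 1 / x_l increase, so passing from 1 / x_j to 1 / x_(j+1) only raises the bound
    [D j.+1 / x j]; at the end [D n <= 0]. *)
Lemma sum_ratio_le x a n :
  (forall l, (l < n)%N -> 0 < x l) ->
  (forall l, (l.+1 < n)%N -> x l.+1 <= x l) ->
  (forall j, (j < n)%N -> \sum_(l < j) x l <= \sum_(l < j) a l) ->
  \sum_(l < n) a l <= \sum_(l < n) x l ->
  \sum_(l < n) a l / x l <= n%:R.
Proof.
move=> xpos xdec xa ax.
pose D j := \sum_(l < j) a l - \sum_(l < j) x l.
have abel j : (j.+1 <= n)%N ->
    \sum_(l < j.+1) a l / x l - j.+1%:R <= D j.+1 / x j.
  elim: j => [|j IHj] jn.
    rewrite /D !big_ord_recr !big_ord0 /= !add0r mulrBl divff //.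
    by rewrite gt_eqF // xpos.
  have xj : 0 < x j by apply: xpos; lia.
  have xj1 : 0 < x j.+1 by apply: xpos.
  have Dj : 0 <= D j.+1 by rewrite subr_ge0 xa.
  have step : D j.+1 / x j <= D j.+1 / x j.+1.
    by rewrite ler_wpM2l // lef_pV2 ?posrE // xdec.
  have DS : D j.+2 / x j.+1 = D j.+1 / x j.+1 + a j.+1 / x j.+1 - 1.
    rewrite /D [in LHS]big_ord_recr [X in _ - X]big_ord_recr /=.
    by field; rewrite gt_eqF.
  have := IHj (ltnW jn).
  rewrite [X in _ -> X - _ <= _]big_ord_recr /= DS -[j.+2%:R]natr1.
  by move: step; lra.
case: n xpos xdec xa ax abel => [|n] xpos xdec xa ax abel.
  by rewrite big_ord0.
have := abel n (leqnn _).
have : D n.+1 / x n <= 0.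
  by rewrite pmulr_lle0 ?invr_gt0 ?xpos // subr_le0.
lra.
Qed.

(** AM-GM for the ratios a_l / x_l, whose mean is at most 1. In the equality case all ratios
    coincide and their common value is 1. *)
Lemma prod_ge_of_majorized x a n :
  (forall l, (l < n)%N -> 0 < x l) -> (forall l, (l < n)%N -> 0 < a l) ->
  (forall l, (l.+1 < n)%N -> x l.+1 <= x l) ->
  (forall j, (j < n)%N -> \sum_(l < j) x l <= \sum_(l < j) a l) ->
  \sum_(l < n) a l <= \sum_(l < n) x l ->
  \prod_(l < n) a l <= \prod_(l < n) x l /\
  (\prod_(l < n) a l = \prod_(l < n) x l ->
    forall l, (l < n)%N -> x l = a l).
Proof.
move=> xpos apos xdec xa ax.
have rat := sum_ratio_le x a n xpos xdec xa ax.
case: n xpos apos xdec xa ax rat => [|n] xpos apos xdec xa ax rat.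
  by rewrite !big_ord0; split.
have rpos (l : 'I_n.+1) : 0 < a l / x l.
  by rewrite divr_gt0 ?xpos ?apos.
have Ppos : 0 < \prod_(l < n.+1) x l by apply: prodr_gt0 => l _; apply: xpos.
have := @leif_AGM F _ [set: 'I_n.+1] (fun l => a l / x l).
rewrite cardsT card_ord /= => /(_ (fun l _ => ltW (rpos l))).
under eq_bigl do rewrite inE.
under [X in X / _]eq_bigl do rewrite inE.
rewrite big_split /= prodfV => -[agm agmE].
set r := (\sum_(_ < _) _) in rat agm agmE.
have r0 : 0 <= r by apply: sumr_ge0 => l _; apply: ltW.
have q0 : 0 <= r / n.+1%:R by rewrite divr_ge0 ?ler0n.
have q1 : r / n.+1%:R <= 1 by rewrite ler_pdivrMr ?ltr0n // mul1r.
have qn : (r / n.+1%:R) ^+ n.+1 <= 1 by rewrite exprn_ile1.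
split.
  have := le_trans agm qn.
  by rewrite ler_pdivrMr // mul1r.
move=> aE l ln.
have E1 : \prod_(l < n.+1) a l / \prod_(l < n.+1) x l = 1.
  by rewrite aE divff // gt_eqF.
rewrite E1 in agm agmE.
have Eq : (r / n.+1%:R) ^+ n.+1 = 1 by apply/eqP; rewrite eq_le qn agm.
rewrite Eq eqxx in agmE.
have cst : forall j : 'I_n.+1, a j / x j = a l / x l.
  move=> j; symmetry in agmE.
  by move/forall_inP: agmE => /(_ (Ordinal ln) (in_setT _)) /forall_inP/(_ j (in_setT _))/eqP/= <-.
have rl : r = n.+1%:R * (a l / x l).
  rewrite /r (eq_bigr (fun=> a l / x l)); last by move=> j _; apply: cst.
  by rewrite sumr_const card_ord mulr_natl.
have := Eq; rewrite rl mulrAC divff ?pnatr_eq0 // mul1r => /eqP.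
rewrite pexpr_eq1 //; last by rewrite ltW // (rpos (Ordinal ln)).
move/eqP => H; have x0 := xpos l ln.
by rewrite -[a l](@divfK _ (x l)) ?H ?mul1r // gt_eqF.
Qed.

End Majorization.

(** * Reciprocals of the Sylvester numbers *)

Section Sylvester.
Variable F : realFieldType.

Lemma sylvprod_gt0 k : (0 < sylvprod k)%N.
Proof. by elim: k => //= k IH; rewrite muln_gt0 IH. Qed.

Lemma prod_sylvV n : \prod_(l < n) (sylv l.+1)%:R^-1 = (sylvprod n)%:R^-1 :> F.
Proof.
elim: n => [|n IH]; first by rewrite big_ord0 invr1.
by rewrite big_ord_recr /= IH /sylv /= natrM invfM.
Qed.

(** Telescoping: with P_n = s_1 ... s_n, 1 / (P_n + 1) = 1 / P_n - 1 / P_(n+1). *)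
Lemma sum_sylvV n :
  \sum_(l < n) (sylv l.+1)%:R^-1 = 1 - (sylvprod n)%:R^-1 :> F.
Proof.
elim: n => [|n IH]; first by rewrite big_ord0 /= invr1 subrr.
rewrite big_ord_recr /= IH /sylv /= natrM -natr1; field.
by rewrite natr1 !pnatr_eq0 (gtn_eqF (sylvprod_gt0 n)).
Qed.

(* An extremal sequence would be majorized by the Sylvester reciprocals, which
   bounds its product from below; the product-sum hypothesis bounds the same
   product from above. *)
Lemma sum_le_sylv (x : nat -> F) n :
  (forall l, (l < n)%N -> 0 < x l) ->
  (forall l, (l.+1 < n)%N -> x l.+1 <= x l) ->
  (forall j, (j <= n)%N -> \prod_(l < j) x l <= 1 - \sum_(l < j) x l) ->
  \sum_(l < n) x l <= 1 - (sylvprod n)%:R^-1 /\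
  (\sum_(l < n) x l = 1 - (sylvprod n)%:R^-1 ->
    forall l, (l < n)%N -> x l = (sylv l.+1)%:R^-1).
Proof.
elim/ltn_ind: n => n IH xpos xdec psi.
have maj : 1 - (sylvprod n)%:R^-1 <= \sum_(l < n) x l ->
    1 - (sylvprod n)%:R^-1 = \sum_(l < n) x l /\
    forall l, (l < n)%N -> x l = (sylv l.+1)%:R^-1.
  move=> ge; have pn := psi n (leqnn _).
  have [] := prod_ge_of_majorized F x (fun l => (sylv l.+1)%:R^-1) n xpos.
  - by move=> l _; rewrite invr_gt0 ltr0n.
  - exact: xdec.
  (* Proper prefixes obey the bound by the induction hypothesis. *)
  - move=> j jn; rewrite sum_sylvV.
    have [] // := IH j jn.
    + by move=> l lj; apply: xpos; lia.
    + by move=> l lj; apply: xdec; lia.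
    + by move=> l lj; apply: psi; lia.
  - by rewrite sum_sylvV.
  rewrite prod_sylvV => le eq; split; first by lra.
  by apply: eq; lra.
split; last by move=> E; have [] := maj _ => //; rewrite E.
rewrite leNgt; apply/negP => lt.
have [E _] := maj (ltW lt).
by rewrite E ltxx in lt.
Qed.

(** For k < l, s_(k+1) divides s_1 ... s_l = s_(l+1) - 1. *)
Lemma coprime_sylv k l : k != l -> coprime (sylv k.+1) (sylv l.+1).
Proof.
wlog kl : k l / (k < l)%N.
  move=> H ne; have [kl|lk|kl] := ltngtP k l; first exact: H.
    by rewrite coprime_sym; apply: H; rewrite 1?eq_sym.
  by rewrite kl eqxx in ne.
move=> _.
have : (sylv k.+1 %| sylvprod l)%N.
  elim: l kl => // l IH; rewrite ltnS leq_eqVlt => /orP[/eqP->|kl] /=.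
    exact: dvdn_mull.
  by rewrite dvdn_mulr // IH.
move=> dv; have := coprimenS (sylvprod l).
rewrite coprime_sym; rewrite -/(sylv l.+1) => cop.
by rewrite coprime_sym; apply: coprime_dvdr dv _.
Qed.

End Sylvester.

(** * Pigeonhole and the product-sum inequality for integers *)

(** On the box 0 <= y_k < p_k (k in A), [f] takes at most g * q^(|A|-1) values: it records the sum
    modulo g and, for k other than [a], y_k + p_k * floor(sum / g) modulo q. A collision makes y_k -
    y'_k + p_k N divisible by q, where N is the difference of the two quotients. *)
Lemma pigeonhole_pair (I : finType) (p : I -> nat) (q g : nat) (A : {set I})
    (a : I) : a \in A -> (0 < g)%N ->
  (q = g + \sum_(k in A) p k)%N ->
  (q ^ #|A|.-1 * g < \prod_(k in A) p k)%N ->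
  exists y y' : I -> nat,
    [/\ (exists2 k, k \in A & y k != y' k),
        (forall k, k \in A -> (y k < p k)%N /\ (y' k < p k)%N) &
        exists N : int, exists n : I -> int, forall k, k \in A ->
          (\sum_(k in A) n k = N) /\
          n k * q%:Z = (y k)%:Z - (y' k)%:Z + (p k)%:Z * N].
Proof.
move=> aA g0 qE lt.
have q0 : (0 < q)%N by lia.
pose box := pfamily (Ordinal q0) (mem A) (fun k => [pred z : 'I_q | (z < p k)%N]).
pose sm (y : {ffun I -> 'I_q}) := (\sum_(k in A) y k)%N.
pose f (y : {ffun I -> 'I_q}) : 'I_g * {ffun {k | k \in A :\ a} -> 'I_q} :=
  (Ordinal (ltn_pmod (sm y) g0),
   [ffun k => Ordinal (ltn_pmod (y (val k) + p (val k) * (sm y %/ g))%N q0)]).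
have pq k : k \in A -> (p k <= q)%N.
  by move=> kA; rewrite qE (bigD1 k) //=; lia.
have cbox : #|box| = (\prod_(k in A) p k)%N.
  rewrite card_pfamily foldrE big_image /=.
  apply: eq_bigr => k kA.
  by rewrite -sum1_card (big_ord_narrow (pq k kA)) sum_nat_const card_ord muln1.
have : ~~ [forall y in box, forall y' in box, (f y == f y') ==> (y == y')].
  apply/negP => inj; have : (#|box| <= #|{: 'I_g * {ffun {k | k \in A :\ a} -> 'I_q}}|)%N.
    apply: (@leq_card_in _ _ f) => y y' yb yb' E.
    move/forall_inP: inj => /(_ y yb)/forall_inP/(_ y' yb').
    by rewrite E eqxx => /eqP.
  rewrite cbox card_prod card_ffun !card_ord card_sig.
  rewrite (_ : #|_| = #|A|.-1); first by rewrite mulnC leqNgt lt.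
  by rewrite (cardsD1 a A) aA.
case/forall_inPn => y yb /forall_inPn[y' yb']; rewrite negb_imply => /andP[/eqP fE ne].
have /pfamilyP[ys yA] := yb; have /pfamilyP[ys' yA'] := yb'.
exists (fun k => y k : nat), (fun k => y' k : nat); split.
- apply/exists_inP; apply: contraNT ne; rewrite negb_exists_in => /forall_inP H.
  apply/eqP/ffunP => k; case: (boolP (k \in A)) => kA.
    by apply/val_inj/eqP; have := H k kA; rewrite negbK.
  by rewrite (supportP ys k kA) (supportP ys' k kA).
- by move=> k kA; have := yA k kA; have := yA' k kA; rewrite !inE.
have [/(congr1 val)/= sE rE] : (f y).1 = (f y').1 /\ (f y).2 = (f y').2 by rewrite fE.
pose N : int := (sm y %/ g)%N%:Z - (sm y' %/ g)%N%:Z.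
pose w k : int := (y k)%:Z - (y' k)%:Z + (p k)%:Z * N.
have sN : (sm y)%:Z - (sm y')%:Z = N * g%:Z.
  by rewrite {1}(divn_eq (sm y) g) {1}(divn_eq (sm y') g) sE /N; lia.
(* The p_k sum to q - g over A, so the w_k sum to N g + N (q - g) = N q. *)
have sw : \sum_(k in A) w k = N * q%:Z.
  rewrite /w big_split sumrB /= -mulr_suml -!(big_morph Posz PoszD (erefl 0%:Z)) -/(sm y) -/(sm y') sN qE.
  by rewrite PoszD; ring.
have dvD k : k \in A :\ a -> (q%:Z %| w k)%Z.
  move=> kA; have /ffunP/(_ (Sub k kA)) := rE; rewrite !ffunE => /(congr1 val)/= E.
  rewrite /w /N.
  set u := (y k + _)%N in E; set u' := (y' k + _)%N in E.
  suff -> : (y k)%:Z - (y' k)%:Z + (p k)%:Z * ((sm y %/ g)%N%:Z - (sm y' %/ g)%N%:Z) =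
      ((u %/ q)%N%:Z - (u' %/ q)%N%:Z) * q%:Z by apply: dvdz_mull.
  have := divn_eq u q; have := divn_eq u' q; rewrite -E /u /u' => E1 E2.
  move: (congr1 Posz E1) (congr1 Posz E2); rewrite !PoszD !PoszM => F1 F2.
  by clear -F1 F2; lia.
(* The coordinate at [a], which [f] does not record, follows from the sum. *)
have dvA k : k \in A -> (q%:Z %| w k)%Z.
  case: (eqVneq k a) => [-> _|ka kA]; last by apply: dvD; rewrite !inE ka.
  have -> : w a = N * q%:Z - \sum_(k in A :\ a) w k.
    rewrite -sw (big_setD1 a) //=; ring.
  rewrite rpredB ?dvdz_mull //; exact: rpred_sum.
exists N, (fun k => (w k %/ q%:Z)%Z) => k kA; split; last by rewrite divzK ?dvA.
have qn : q%:Z != 0 by lia.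
apply: (mulIf qn); rewrite mulr_suml -sw; apply: eq_bigr => l lA.
by rewrite divzK ?dvA.
Qed.

(* [n] and [N] encode the lattice point (N + 1) x - sum_k n_k v_k, whose
   barycentric coordinates are (N + 1) p_k / q - n_k: the hypothesis [uniq]
   says that no such point other than x lies in the interior. *)
Lemma product_sum_nat (I : finType) (p : I -> nat) (q : nat) (A : {set I})
    (k0 : I) (uniq : forall (n : I -> int) (N : nat), \sum_k n k = N%:Z ->
      (forall k, n k * q%:Z < N.+1%:Z * (p k)%:Z) ->
      forall k, n k * q%:Z = N%:Z * (p k)%:Z) :
  (forall k, 0 < p k)%N -> (\sum_k p k)%N = q -> k0 \notin A ->
  (\prod_(k in A) p k * q <= q ^ #|A| * \sum_(k in ~: A) p k)%N.
Proof.
move=> p0 sq k0A.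
set g := (\sum_(k in ~: A) p k)%N.
have g0 : (0 < g)%N by rewrite /g (bigD1 k0) ?inE //=; have := p0 k0; lia.
have qE : q = (g + \sum_(k in A) p k)%N.
  rewrite -sq addnC (bigID (mem A)) /=; congr (_ + _)%N.
  by apply: eq_bigl => k; rewrite inE.
case: (set_0Vmem A) => [A0|[a aA]].
  by rewrite qE A0 cards0 !big_set0 addn0; lia.
rewrite leqNgt; apply/negP => lt.
have cA : #|A| = #|A|.-1.+1 by rewrite prednK // (cardD1 a) aA.
have {}lt : (q ^ #|A|.-1 * g < \prod_(k in A) p k)%N.
  move: lt; rewrite {1}cA expnS -mulnA mulnC ltn_mul2r; lia.
have [y [y' [[k kA ne] yp [N [n nE]]]]] := pigeonhole_pair I p q g A a aA g0 qE lt.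
(* Exchanging y and y' negates both n and N. *)
wlog N0 : y y' N n ne yp nE / 0 <= N.
  move=> H; case: (leP 0 N) => N0; first exact: (H y y' N n).
  apply: (H y' y (- N) (fun k => - n k)); rewrite 1?eq_sym //.
  - by move=> l lA; have [] := yp l lA.
  - move=> l lA; have [<- E] := nE l lA; split; first by rewrite sumrN.
    by rewrite mulNr E (nE l lA).1; ring.
  - lia.
have {N0} [M NM] : exists M : nat, N = M%:Z by exists (absz N); lia.
rewrite {N}NM in nE.
pose n' l := if l \in A then n l else 0.
have E := uniq n' M; have {E} : forall k, n' k * q%:Z = M%:Z * (p k)%:Z.
  apply: E; first by rewrite -big_mkcond /=; exact: (nE a aA).1.
  move=> l; rewrite /n'; case: ifP => lA; last by have := p0 l; nia.
  by have [_ ->] := nE l lA; have [] := yp l lA; lia.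
(* At [k0], outside A, [n'] vanishes while p is positive, so M = 0; then y and y' agree at k,
   against its choice. *)
move=> E; have M0 : M = 0%N.
  by have := E k0; rewrite /n' (negbTE k0A) mul0r; have := p0 k0; nia.
by have := E k; rewrite /n' kA (nE k kA).2 M0; lia.
Qed.

(** * Barycentric coordinates, interiors and affine images of simplices *)

Section Barycentric.
Variables (R : realFieldType) (d : nat).
Implicit Types (V W : 'M[R]_(d.+1, d)) (x y : 'rV[R]_d) (b : 'I_d.+1 -> R).

(** With rows (1, v_k), affine independence becomes invertibility and barycentric coordinates solve
    a linear system. *)
Definition homog V : 'M[R]_(1 + d) := row_mx (const_mx 1) V.

Lemma sum_scale_row (m n : nat) (b : 'I_m -> R) (M : 'M[R]_(m, n)) :
  \sum_k b k *: row k M = (\row_k b k) *m M.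
Proof. by rewrite mulmx_sum_row; apply: eq_bigr => k _; rewrite mxE. Qed.

Lemma row_mul_homog V b :
  (\row_k b k) *m homog V =
  row_mx (\sum_k b k)%:M (\sum_k b k *: row k V) :> 'rV_(1 + d).
Proof.
rewrite /homog mul_mx_row sum_scale_row; congr row_mx.
by apply/matrixP => i j; rewrite !ord1 !mxE; apply: eq_bigr => k _; rewrite !mxE mulr1.
Qed.

Lemma is_baryE V x b :
  is_bary V x b <-> (\row_k b k) *m homog V = row_mx 1%:M x.
Proof.
rewrite row_mul_homog; split=> [[-> <-]//|/eq_row_mx[s1 <-]]; split=> //.
by move/matrixP/(_ 0 0): s1; rewrite !mxE.
Qed.

Lemma homog_unit V : aff_indep V -> homog V \in unitmx.
Proof.
move=> ai; rewrite -row_free_unit; apply: inj_row_free => v v0.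
have vE : v = \row_k v 0 k by apply/rowP => k; rewrite mxE.
move: v0; rewrite {1}vE (row_mul_homog V (fun k => v 0 k)).
rewrite -[X in _ = X -> _]row_mx0.
move=> /eq_row_mx[/matrixP/(_ 0 0) s0 t0].
rewrite !mxE in s0; apply/rowP => k; rewrite mxE.
exact: (ai (fun l => v 0 l) s0 t0 k).
Qed.

Lemma is_bary_inv V x b : aff_indep V ->
  is_bary V x b <-> \row_k b k = row_mx 1%:M x *m invmx (homog V).
Proof.
move=> /homog_unit Hu; rewrite is_baryE; split=> [<-|->]; first by rewrite mulmxK.
by rewrite mulmxKV.
Qed.

Lemma is_bary_uniq V x b b' : aff_indep V ->
  is_bary V x b -> is_bary V x b' -> b =1 b'.
Proof.
move=> ai /(is_bary_inv _ _ _ ai) E /(is_bary_inv _ _ _ ai); rewrite -E.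
by move=> /rowP H k; have := H k; rewrite !mxE.
Qed.

Lemma is_bary_exists V x : aff_indep V -> exists b, is_bary V x b.
Proof.
move=> ai; exists (fun k => (row_mx 1%:M x *m invmx (homog V)) 0 k).
by apply/(is_bary_inv _ _ _ ai)/rowP => k; rewrite mxE.
Qed.

(** Pushing x slightly away from vertex k stays in the simplex and turns b_k into b_k + t (b_k - 1),
    which can be nonnegative only if b_k > 0. *)
Lemma interior_bary_gt0 V x b : aff_indep V -> is_bary V x b ->
  interior (conv V) x -> forall k, 0 < b k.
Proof.
move=> ai [b1 xE] [e e0 eP] k.
pose S := \sum_j `|x 0 j - V k j|.
have S0 : 0 <= S by apply: sumr_ge0.
(* Each coordinate moves by at most t S < e; the summand 1 covers S = 0. *)
pose t := e / (1 + S).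
have S1 : 0 < 1 + S by lra.
have t0 : 0 < t by rewrite divr_gt0.
have [j|lam [lam0 [lam1 yE]]] := eP (x + t *: (x - row k V)).
  rewrite !mxE addrAC subrr add0r normrM gtr0_norm //.
  have : `|x 0 j - V k j| <= S.
    by rewrite /S (bigD1 j) //= lerDl; apply: sumr_ge0.
  rewrite /t mulrAC ltr_pdivrMr // ltr_pM2l //; lra.
pose c l := b l + t * (b l - (l == k)%:R).
have cy : is_bary V (x + t *: (x - row k V)) c.
  split; first by rewrite big_split -mulr_sumr sumrB /= b1 (bigD1 k) //= eqxx big1 ?addr0 ?subrr ?mulr0 ?addr0 // => l /negbTE->.
  transitivity (\sum_l (b l *: row l V + t *: (b l *: row l V - (l == k)%:R *: row l V))).
    rewrite big_split /= -scaler_sumr sumrB -xE (bigD1 k) //= eqxx scale1r.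
    by rewrite big1 ?addr0 // => l /negbTE->; rewrite scale0r.
  by apply: eq_bigr => l _; rewrite -scalerBl scalerA -scalerDl.
have := is_bary_uniq _ _ _ _ ai cy (conj lam1 yE) k.
rewrite /c eqxx mulr1n => E; have := lam0 k; rewrite -E => H.
rewrite ltNge; apply/negP => bk.
have : t * b k <= 0 by rewrite pmulr_rle0.
lra.
Qed.

(** Barycentric coordinates are Lipschitz in the point, with a constant [C] read off the inverse
    matrix; a move below e / C changes each by at most e, which is at most every b_k. *)
Lemma bary_gt0_interior V x b : aff_indep V -> is_bary V x b ->
  (forall k, 0 < b k) -> interior (conv V) x.
Proof.
move=> ai bx b0.
pose C : R := 1 + \sum_i \sum_j `|invmx (homog V) i j|.
have C0 : 0 < C.
  by apply: ltr_pwDl => //; apply: sumr_ge0 => i _; apply: sumr_ge0.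
pose e := \big[Order.min/1]_k b k.
have e0 : 0 < e by rewrite /e; apply: (big_ind (fun z => 0 < z)) => // u v u0 v0; rewrite lt_min u0.
have eb k : e <= b k by apply: bigmin_le.
exists (e / C) => [|y ye]; first by rewrite divr_gt0.
have [c cy] := is_bary_exists V y ai.
exists c; split; last exact: cy.
move=> k.
have bE := (is_bary_inv _ _ _ ai).1 bx.
have cE := (is_bary_inv _ _ _ ai).1 cy.
have dE : c k - b k = \sum_j (y 0 j - x 0 j) * invmx (homog V) (rshift 1 j) k.
  have -> : c k - b k = (\row_l c l - \row_l b l) 0 k by rewrite !mxE.
  rewrite cE bE -mulmxBl opp_row_mx add_row_mx subrr mxE big_split_ord /=.
  rewrite big1 ?add0r; last by move=> j _; rewrite row_mxEl mxE mul0r.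
  by apply: eq_bigr => j _; rewrite row_mxEr !mxE.
have : `|c k - b k| <= e.
  rewrite dE; apply: (le_trans (ler_norm_sum _ _ _)).
  apply: (@le_trans _ _ (\sum_j e / C * `|invmx (homog V) (rshift 1 j) k|)).
    apply: ler_sum => j _; rewrite normrM; apply: ler_wpM2r => //.
    exact/ltW/ye.
  rewrite -mulr_sumr mulrAC ler_pdivrMr // ler_pM2l //.
  rewrite /C big_split_ord /= addrA; apply: ler_wpDl.
    by rewrite addr_ge0 //; apply: sumr_ge0 => i _; apply: sumr_ge0.
  apply: ler_sum => j _; rewrite [leRHS](bigD1 k) //= lerDl.
  exact: sumr_ge0.
rewrite ler_norml => /andP[H _]; have := eb k; lra.
Qed.

Lemma affine_sum V (A : 'M[R]_d) (v : 'rV[R]_d) b : \sum_k b k = 1 ->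
  (\sum_k b k *: row k V) *m A + v = \sum_k b k *: (row k V *m A + v).
Proof.
move=> b1; rewrite mulmx_suml -[v in LHS]scale1r -b1 scaler_suml -big_split /=.
by apply: eq_bigr => k _; rewrite scalerDr scalemxAl.
Qed.

(* A vertex of conv W, written as a convex combination of images of vertices of
   V, must be one of them, since its own W-coordinate is maximal. *)
Lemma affine_equiv_vertices V W (A : 'M[R]_d) (v : 'rV[R]_d) : aff_indep W ->
  (forall y, conv W y <-> exists2 x, conv V x & x *m A + v = y) ->
  exists pi : 'S_d.+1, forall k, row (pi k) V *m A + v = row k W.
Proof.
move=> ai cE.
have vert (U : 'M[R]_(d.+1, d)) k : conv U (row k U).
  exists (fun l => (l == k)%:R); split=> [l|]; first exact: ler0n.
  by split; rewrite (bigD1 k) //= eqxx ?scale1r big1 ?addr0 // => l /negbTE->; rewrite ?scale0r.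
have ex k : exists l, row l V *m A + v == row k W.
  have [p [lam [lam0 [lam1 ->]]]] := (cE _).1 (vert W k).
  rewrite affine_sum // => pE.
  have /fin_all_exists[mu muP] l : exists mu : 'I_d.+1 -> R,
      (forall m, 0 <= mu m) /\ is_bary W (row l V *m A + v) mu.
    have [|mu [mu0 [mu1 muE]]] := (cE (row l V *m A + v)).2.
      by exists (row l V).
    by exists mu.
  have bk : is_bary W (row k W) (fun m => (m == k)%:R).
    by split; rewrite (bigD1 k) //= eqxx ?scale1r big1 ?addr0 // => l /negbTE->; rewrite ?scale0r.
  have bk' : is_bary W (row k W) (fun m => \sum_l lam l * mu l m).
    split.
      rewrite exchange_big -[RHS]lam1 /=; apply: eq_bigr => l _.
      by rewrite -mulr_sumr (muP l).2.1 mulr1.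
    rewrite -pE.
    transitivity (\sum_l \sum_m lam l *: (mu l m *: row m W)).
      by apply: eq_bigr => l _; rewrite -scaler_sumr -(muP l).2.2.
    rewrite exchange_big; apply: eq_bigr => m _ /=.
    by rewrite scaler_suml; apply: eq_bigr => l _; rewrite scalerA.
  have E1 := is_bary_uniq _ _ _ _ ai bk bk' k; rewrite eqxx in E1.
  have mule1 l m : mu l m <= 1.
    by rewrite -(muP l).2.1 (bigD1 m) //= lerDl; apply: sumr_ge0 => i _; apply: (muP l).1.
  have E0 : \sum_l lam l * (1 - mu l k) = 0.
    by under eq_bigr do rewrite mulrBr mulr1; rewrite sumrB lam1 -E1 subrr.
  have /psumr_eq0P H := E0.
  have {}H l : lam l * (1 - mu l k) = 0.
    by apply: H => // j _; rewrite mulr_ge0 // subr_ge0.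
  have [l ll] : exists l, lam l != 0.
    case: (boolP [exists l, lam l != 0]) => [/existsP//|].
    rewrite negb_exists => /forallP H0.
    move: lam1; rewrite big1 => [/eqP|l _]; first by rewrite eq_sym oner_eq0.
    by apply/eqP; have := H0 l; rewrite negbK.
  exists l; have mk : mu l k = 1.
    by have /eqP := H l; rewrite mulf_eq0 (negbTE ll) subr_eq0 => /eqP.
  have mu0 m : m != k -> mu l m = 0.
    move=> mk'; have := (muP l).2.1; rewrite (bigD1 k) //= mk (bigD1 m) //=.
    have : 0 <= \sum_(i | (i != k) && (i != m)) mu l i by apply: sumr_ge0 => i _; apply: (muP l).1.
    have := (muP l).1 m; lra.
  rewrite (muP l).2.2 (bigD1 k) //= mk scale1r big1 ?addr0 // => m mk'.
  by rewrite mu0 // scale0r.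
pose f k := xchoose (ex k).
have fE k : row (f k) V *m A + v = row k W by apply/eqP/(xchooseP (ex k)).
have finj : injective f.
  move=> k l fkl; apply/eqP; apply/negPn/negP => kl.
  have E : row k W = row l W by rewrite -!fE fkl.
  have := ai (fun m => (m == k)%:R - (m == l)%:R) _ _ k.
  rewrite eqxx (negbTE kl) subr0 => H.
  suff /eqP : true%:R = 0 :> R by rewrite oner_eq0.
  apply: H.
    by rewrite sumrB (bigD1 k) //= eqxx [X in _ - X](bigD1 l) //= eqxx !big1 ?addr0 ?subrr // => m /negbTE->.
  under eq_bigr do rewrite scalerBl.
  rewrite sumrB (bigD1 k) //= eqxx [X in _ - X](bigD1 l) //= eqxx !big1 ?addr0 ?scale1r ?E ?subrr // => m /negbTE->; exact: scale0r.
by exists (perm finj) => k; rewrite permE.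
Qed.

Lemma conv_affine_image V W (A : 'M[R]_d) (v : 'rV[R]_d) (pi : 'S_d.+1) :
  (forall k, row (pi k) V *m A + v = row k W) ->
  forall y, conv W y <-> exists2 x, conv V x & x *m A + v = y.
Proof.
move=> piE y; split=> [[lam [lam0 [lam1 ->]]]|[x [lam [lam0 [lam1 ->]]] <-]].
  exists (\sum_k lam k *: row (pi k) V).
    exists (fun k => lam ((pi^-1)%g k)); split=> //; split.
      by rewrite (reindex_inj (@perm_inj _ pi)) -[RHS]lam1 /=; apply: eq_bigr => k _; rewrite permK.
    by rewrite [RHS](reindex_inj (@perm_inj _ pi)) /=; apply: eq_bigr => k _; rewrite permK.
  have E : \sum_k lam k *: row (pi k) V = \sum_k lam ((pi^-1)%g k) *: row k V.
    by rewrite [RHS](reindex_inj (@perm_inj _ pi)) /=; apply: eq_bigr => k _; rewrite permK.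
  rewrite E affine_sum.
    rewrite (reindex_inj (@perm_inj _ pi)) /=; apply: eq_bigr => k _.
    by rewrite permK piE.
  by rewrite (reindex_inj (@perm_inj _ pi)) -[RHS]lam1 /=; apply: eq_bigr => k _; rewrite permK.
exists (fun k => lam (pi k)); split=> //; split.
  by rewrite -lam1 [RHS](reindex_inj (@perm_inj _ pi)).
rewrite affine_sum // (reindex_inj (@perm_inj _ pi)) /=; apply: eq_bigr => k _.
by rewrite piE.
Qed.

End Barycentric.

(** * Inequalities for a simplex with a single interior lattice point *)

Section UniqueInteriorPoint.
Variables (R : realFieldType) (d : nat) (V : 'M[int]_(d.+1, d)).

(** Cramer's rule for the homogenized vertex matrix; its determinant is squared to get a positive
    denominator. *)
Lemma intpt_bary_quot (x : 'rV[R]_d) b :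
  aff_indep (rmx R V) -> intpt x -> is_bary (rmx R V) x b ->
  exists2 D : nat, (0 < D)%N &
    exists p : 'I_d.+1 -> int, forall k, b k = (p k)%:~R / D%:R.
Proof.
move=> ai [z ->] /(is_bary_inv _ _ _ _ _ ai) bE.
pose H : 'M[int]_(1 + d) := row_mx (const_mx 1) V.
have HE : homog R d (rmx R V) = map_mx intr H.
  by rewrite map_row_mx map_const_mx.
have := homog_unit _ _ _ ai; rewrite HE => Hu.
have det0 : (\det H)%:~R != 0 :> R.
  by rewrite -unitfE -[_%:~R](det_map_mx intr) -unitmxE.
exists (`|\det H ^+ 2|)%N.
  by rewrite absz_gt0 expf_neq0 //; apply: contraNneq det0 => ->.
pose w : 'rV[int]_(1 + d) := row_mx 1%:M z *m \adj H.
exists (fun k => w 0 k * \det H) => k.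
have := congr1 (fun M : 'rV_d.+1 => M 0 k) bE; rewrite mxE => ->.
rewrite HE /invmx Hu -scalemxAr det_map_mx -map_mx_adj.
have -> : row_mx 1%:M (map_mx (fun t : int => t%:~R) z) = map_mx intr (row_mx 1%:M z : 'rV_(1 + d)) :> 'rV[R]_(1 + d).
  by rewrite map_row_mx map_mx1.
rewrite -map_mxM !mxE -/w natr_absz ger0_norm ?sqr_ge0 // intrM rmorphXn /=.
by field.
Qed.

Variables (x : 'rV[R]_d) (beta : 'I_d.+1 -> R).
Hypotheses (Sd1 : in_Sd1 R V) (xint : intpt x).
Hypotheses (xin : interior (conv (rmx R V)) x) (xb : is_bary (rmx R V) x beta).

Lemma bary_gt0 k : 0 < beta k.
Proof. by apply: interior_bary_gt0 xin k => //; case: Sd1. Qed.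

Lemma interior_bary_uniq y b : intpt y -> is_bary (rmx R V) y b ->
  (forall k, 0 < b k) -> b =1 beta.
Proof.
case: Sd1 => ai [x0 [_ x0u]] yint yb b0.
have yin := bary_gt0_interior _ _ _ _ _ ai yb b0.
have yx : y = x by rewrite -(x0u y) // -(x0u x).
by rewrite yx in yb; apply: is_bary_uniq ai yb xb.
Qed.

(** Clearing denominators reduces this to [product_sum_nat]: the coordinates of the lattice point (N
    + 1) x - sum_k n_k v_k, if all positive, must be those of x. *)
Lemma product_sum (A : {set 'I_d.+1}) k0 : k0 \notin A ->
  \prod_(k in A) beta k <= 1 - \sum_(k in A) beta k.
Proof.
move=> k0A; have [ai _] := Sd1.
have [D D0 [pz pE]] := intpt_bary_quot x beta ai xint xb.
have DR : 0 < D%:R :> R by rewrite ltr0n.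
have Dn : D%:R != 0 :> R by rewrite gt_eqF.
have pz0 k : 0 < pz k.
  by have := bary_gt0 k; rewrite pE pmulr_lgt0 ?invr_gt0 // ltr0z.
pose p k := `|pz k|%N.
have {}pE k : beta k = (p k)%:R / D%:R.
  by rewrite pE /p natr_absz gtr0_norm.
have p0 k : (0 < p k)%N by rewrite /p absz_gt0 gt_eqF.
have sp : (\sum_k p k)%N = D.
  apply/eqP; rewrite -(eqr_nat R) natr_sum -(inj_eq (mulIf (invr_neq0 Dn))).
  rewrite divff // mulr_suml (eq_bigr beta); last by move=> k _; rewrite pE.
  exact/eqP/xb.1.
have uniq (n : 'I_d.+1 -> int) (N : nat) : \sum_k n k = N%:Z ->
    (forall k, n k * D%:Z < N.+1%:Z * (p k)%:Z) ->
    forall k, n k * D%:Z = N%:Z * (p k)%:Z.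
  move=> sn nlt k.
  have [z xz] := xint.
  pose b k := N.+1%:R * beta k - (n k)%:~R.
  have nE l : (n l)%:~R < N.+1%:R * beta l.
    rewrite pE mulrA ltr_pdivlMr //.
    by have := nlt l; rewrite -(ltr_int R) !intrM.
  have bb : b =1 beta.
    apply: (interior_bary_uniq (\sum_k b k *: row k (rmx R V))).
    - exists (N.+1%:Z *: z - \sum_k n k *: row k V).
      rewrite raddfB /= map_mxZ raddf_sum /= -xz xb.2 /b.
      under eq_bigr do rewrite scalerBl -scalerA.
      rewrite sumrB -scaler_sumr; congr (_ - _).
      apply: eq_bigr => l _; rewrite map_mxZ map_row //.
    - split=> //; rewrite sumrB -mulr_sumr xb.1 mulr1 -(rmorph_sum intr) sn.
      by rewrite -natr1 /=; ring.
    - by move=> l; rewrite subr_gt0.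
  apply/eqP; rewrite -(eqr_int R) !intrM /=.
  have := bb k; rewrite /b pE -natr1 => E.
  have -> : (n k)%:~R = N%:R * ((p k)%:R / D%:R) :> R by lra.
  by rewrite -mulrA divfK.
have := product_sum_nat _ p D A k0 uniq p0 sp k0A.
rewrite -(ler_nat R) !natrM natr_prod natrX natr_sum => H.
have sA : 1 - \sum_(k in A) beta k = \sum_(k in ~: A) beta k.
  rewrite -xb.1 (bigID (mem A)) /= addrAC subrr add0r.
  by apply: eq_bigl => k; rewrite inE.
rewrite sA.
have -> : \prod_(k in A) beta k = (\prod_(k in A) (p k)%:R) / D%:R ^+ #|A|.
  rewrite (eq_bigr (fun k => (p k)%:R / D%:R)); last by move=> k _; apply: pE.
  by rewrite big_split /= prodr_const exprVn.
have -> : \sum_(k in ~: A) beta k = (\sum_(k in ~: A) (p k)%:R) / D%:R.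
  by rewrite mulr_suml; apply: eq_bigr => k _; apply: pE.
rewrite ler_pdivrMr ?exprn_gt0 // mulrAC ler_pdivlMr //.
by rewrite [leRHS]mulrC.
Qed.

Variable s : 'S_d.+1.
Hypothesis sorted : forall j k : 'I_d.+1, (j <= k)%N -> beta (s k) <= beta (s j).

(** A general commutative law serves both the sum and the product of the j largest coordinates. *)
Lemma big_sorted_prefix (idx : R) (op : Monoid.com_law idx) j
    (jd : (j <= d.+1)%N) :
  \big[op/idx]_(k in [set k | ((s^-1)%g k < j)%N]) beta k =
  \big[op/idx]_(l < j) beta (s (inord l)).
Proof.
rewrite (reindex_inj (@perm_inj _ s)) /=.
rewrite (eq_bigl (fun k : 'I_d.+1 => (k < j)%N)); last by move=> k; rewrite inE permK.
rewrite (big_ord_narrow jd); apply: eq_bigr => l _; congr (beta (s _)).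
by apply: val_inj; rewrite /= inordK //; apply: leq_trans (ltn_ord l) jd.
Qed.

Lemma prefix_sum_le (i : 'I_d.+1) :
  \sum_(k < d.+1 | (k < i)%N) beta (s k) <= 1 - (sylvprod i)%:R^-1 /\
  (\sum_(k < d.+1 | (k < i)%N) beta (s k) = 1 - (sylvprod i)%:R^-1 ->
    forall k : 'I_d.+1, (k < i)%N -> beta (s k) = (sylv k.+1)%:R^-1).
Proof.
pose xs l := beta (s (inord l)).
have xsE : \sum_(k < d.+1 | (k < i)%N) beta (s k) = \sum_(l < i) xs l.
  rewrite (big_ord_narrow (ltnW (ltn_ord i))); apply: eq_bigr => l _.
  congr (beta (s _)); apply: val_inj; rewrite /= inordK //.
  by have := ltn_ord l; have := ltn_ord i; lia.
rewrite xsE; have idlt := ltn_ord i.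
have [] := sum_le_sylv R xs i.
- by move=> l _; apply: bary_gt0.
- by move=> l li; apply: sorted; rewrite !inordK; lia.
- move=> j ji; have jd : (j <= d.+1)%N by lia.
  rewrite -!(big_sorted_prefix _ _ j jd).
  (* As j <= i <= d, the vertex in the last position lies outside the prefix. *)
  by apply: (product_sum _ (s ord_max)); rewrite inE permK /=; lia.
move=> le eq; split=> // E k ki; rewrite -eq // /xs; congr (beta (s _)).
by apply: val_inj; rewrite /= inordK.
Qed.

Lemma sum_tail_const (i : 'I_d.+1) (c : R) :
  \sum_(k < d.+1 | ~~ (k < i)%N) c = (d.+1 - i)%:R * c.
Proof.
have : \sum_(k < d.+1) c = d.+1%:R * c by rewrite sumr_const card_ord mulr_natl.
rewrite (bigID (fun k : 'I_d.+1 => (k < i)%N)) /= (big_ord_narrow (ltnW (ltn_ord i))).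
rewrite sumr_const card_ord -[c *+ i]mulr_natl natrB ?(ltnW (ltn_ord i)) // => E.
by rewrite mulrBl -E; ring.
Qed.

(** The prefix bound leaves at least 1 / (s_1 ... s_i) to the d + 1 - i tail coordinates, each at
    most [beta (s i)]. Equality makes the prefix sum extremal and the tail constant. *)
Lemma sorted_bary_bound (i : 'I_d.+1) :
  let m := (((d.+1 - i) * (sylv i.+1 - 1))%N%:R)^-1 in
  m <= beta (s i) /\
  (beta (s i) = m -> forall j : 'I_d.+1,
    beta (s j) = if (j < i)%N then ((sylv j.+1)%:R)^-1 else m).
Proof.
rewrite /sylv /= subn1 /= natrM invfM.
set r := (d.+1 - i)%:R; set P := (sylvprod i)%:R^-1.
have r0 : 0 < r by rewrite ltr0n subn_gt0.
have [] := prefix_sum_le i; rewrite -/P => le eq.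
have tot : \sum_(k < d.+1 | (k < i)%N) beta (s k) +
    \sum_(k < d.+1 | ~~ (k < i)%N) beta (s k) = 1.
  have := xb.1; rewrite (reindex_inj (@perm_inj _ s)) /=.
  by rewrite (bigID (fun k : 'I_d.+1 => (k < i)%N)).
have tl (k : 'I_d.+1) : ~~ (k < i)%N -> 0 <= beta (s i) - beta (s k).
  by move=> ik; rewrite subr_ge0 sorted // leqNgt.
have tlE : \sum_(k < d.+1 | ~~ (k < i)%N) (beta (s i) - beta (s k)) =
    r * beta (s i) - \sum_(k < d.+1 | ~~ (k < i)%N) beta (s k).
  by rewrite sumrB sum_tail_const.
have tl0 : 0 <= \sum_(k < d.+1 | ~~ (k < i)%N) (beta (s i) - beta (s k)).
  exact: sumr_ge0.
have rP : r * (r^-1 * P) = P by rewrite mulVKf // gt_eqF.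
have main : P <= r * beta (s i) by lra.
split; first by rewrite -(ler_pM2l r0) rP.
move=> E j; have rE : r * beta (s i) = P by rewrite E.
case: ifP => ji; first by apply: eq => //; lra.
have /psumr_eq0P H : \sum_(k < d.+1 | ~~ (k < i)%N) (beta (s i) - beta (s k)) = 0 by lra.
by apply/esym/eqP; rewrite -subr_eq0 -E H ?ji.
Qed.

End UniqueInteriorPoint.

(** * The all-ones point in the simplices T *)

Section StandardSimplex.
Variables (R : realFieldType) (d : nat).

Lemma Tcoef_gt0 j k : (j <= d.+1)%N -> (0 < Tcoef d j k)%N.
Proof.
move=> jd; rewrite /Tcoef; case: ifP => // _.
by rewrite /sylv subn1 /= muln_gt0 sylvprod_gt0 andbT; lia.
Qed.

Lemma sum_row_Tmat j (lam : 'I_d.+1 -> R) c :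
  (\sum_k lam k *: row k (rmx R (Tmat d j))) 0 c =
  lam (lift ord0 c) * (Tcoef d j c.+1)%:R.
Proof.
rewrite summxE (bigD1 (lift ord0 c)) //= !mxE /= eqxx big1 ?addr0 // => k kc.
by rewrite !mxE ifN ?mulr0.
Qed.

Lemma aff_indep_Tmat j : (j <= d.+1)%N -> aff_indep (rmx R (Tmat d j)).
Proof.
move=> jd lam s0 t0.
have l0 c : lam (lift ord0 c) = 0.
  have /rowP/(_ c) := t0; rewrite sum_row_Tmat mxE => /eqP.
  by rewrite mulf_eq0 pnatr_eq0 gtn_eqF ?Tcoef_gt0 // orbF => /eqP.
move=> k; case: (unliftP ord0 k) => [c ->|->] //.
by move: s0; rewrite big_ord_recl big1 ?addr0.
Qed.

(** Barycentric coordinates of (1, ..., 1). Row 0, the origin, falls in the second branch and shares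
    the tail value. *)
Definition Tbary (i : nat) (k : 'I_d.+1) : R :=
  if (0 < k <= i)%N then (sylv k)%:R^-1
  else ((d.+1 - i) * (sylv i.+1 - 1))%N%:R^-1.

Lemma Tbary_lift (i : nat) (c : 'I_d) :
  Tbary i (lift ord0 c) = (Tcoef d i.+1 c.+1)%:R^-1.
Proof. by rewrite /Tbary /Tcoef /= /bump /= add1n ltnS subSS; case: ifP. Qed.

Lemma Tbary_gt0 (i : 'I_d.+1) k : 0 < Tbary i k.
Proof.
rewrite /Tbary; case: ifP => _; rewrite invr_gt0 ltr0n //.
by rewrite /sylv subn1 /= muln_gt0 sylvprod_gt0 subn_gt0 ltn_ord.
Qed.

Lemma is_bary_Tmat (i : 'I_d.+1) :
  is_bary (rmx R (Tmat d i.+1)) (const_mx 1) (Tbary i).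
Proof.
split.
  rewrite big_ord_recl /= {1}/Tbary /=.
  have id : (i <= d)%N by rewrite -ltnS.
  set m := (_%:R^-1).
  have -> : \sum_(c < d) Tbary i (lift ord0 c) =
      \sum_(c < i) (sylv c.+1)%:R^-1 + (d - i)%:R * m.
    have -> : \sum_(c < d) Tbary i (lift ord0 c) =
        \sum_(c < d) (if (c < i)%N then (sylv c.+1)%:R^-1 else m).
      by apply: eq_bigr => c _; rewrite /Tbary /= /bump /= add1n.
    rewrite (bigID (fun c : 'I_d => (c < i)%N)) /= (big_ord_narrow id) /=.
    congr (_ + _); first by apply: eq_bigr => c _; rewrite ltn_ord.
    rewrite (eq_bigr (fun=> m)); last by move=> c /negbTE->.
    have : \sum_(c < d) m = d%:R * m by rewrite sumr_const card_ord mulr_natl.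
    rewrite (bigID (fun c : 'I_d => (c < i)%N)) /= (big_ord_narrow id) sumr_const.
    rewrite card_ord -[m *+ i]mulr_natl natrB // => E.
    by rewrite mulrBl -E; ring.
  (* With P = s_1 ... s_i the sum is m + (1 - 1/P) + (d - i) m, and (d + 1 - i) m = 1/P. *)
  rewrite sum_sylvV /m /sylv subn1 /= natrM subSn // -natr1; field.
  by rewrite natr1 !pnatr_eq0 (gtn_eqF (sylvprod_gt0 _)).
apply/rowP => c; rewrite sum_row_Tmat mxE Tbary_lift mulVf //.
by rewrite pnatr_eq0 gtn_eqF // Tcoef_gt0.
Qed.

End StandardSimplex.

(** * Unimodular equivalence with T *)

Section Equivalence.
Variables (R : realFieldType) (d : nat) (V : 'M[int]_(d.+1, d)).
Variables (x : 'rV[R]_d) (beta : 'I_d.+1 -> R) (s : 'S_d.+1).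
Hypotheses (Sd1 : in_Sd1 R V) (xint : intpt x).
Hypotheses (xin : interior (conv (rmx R V)) x) (xb : is_bary (rmx R V) x beta).
Hypothesis sorted : forall j k : 'I_d.+1, (j <= k)%N -> beta (s k) <= beta (s j).

(** An equivalence permutes vertices and preserves barycentric coordinates; the preimage of (1, ...,
    1) is a lattice point with positive coordinates, hence x. *)
Lemma equiv_Tmat_bary (i : 'I_d.+1) :
  unimod_equiv (conv (rmx R V)) (conv (rmx R (Tmat d i.+1))) ->
  exists pi : 'S_d.+1, forall k, beta (pi k) = Tbary R d i k.
Proof.
move=> [A [v [Au [latE convE]]]].
have [pi piE] := affine_equiv_vertices R d _ _ A v (aff_indep_Tmat R d i.+1 (ltn_ord i)) convE.
exists pi.
have [T1 TE] := is_bary_Tmat R d i.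
have [|z zint zE] := (latE (const_mx 1)).1.
  by exists (const_mx 1); rewrite map_const_mx.
pose b k := Tbary R d i ((pi^-1)%g k).
have b1 : \sum_k b k = 1.
  by rewrite (reindex_inj (@perm_inj _ pi)) -[RHS]T1; apply: eq_bigr => k _; rewrite /b permK.
have bz : is_bary (rmx R V) z b.
  split=> //.
  have : z *m A + v = (\sum_k b k *: row k (rmx R V)) *m A + v.
    rewrite zE affine_sum // TE [RHS](reindex_inj (@perm_inj _ pi)).
    by apply: eq_bigr => k _; rewrite /b permK piE.
  by move/addIr/(can_inj (mulmxK Au)).
move=> k; rewrite -(interior_bary_uniq R d V x beta Sd1 xint xin xb z b) //.
  by rewrite /b permK.
by move=> l; apply: Tbary_gt0.
Qed.

(** Counting replaces sorting the values of [Tbary]: only i vertices lie in its first branch, so one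
    of the i + 1 largest coordinates is the tail value, and [beta (s i)] is the least of these i +
    1. *)
Lemma equiv_Tmat_le (i : 'I_d.+1) :
  unimod_equiv (conv (rmx R V)) (conv (rmx R (Tmat d i.+1))) ->
  beta (s i) <= ((d.+1 - i) * (sylv i.+1 - 1))%N%:R^-1.
Proof.
move=> /equiv_Tmat_bary[pi piE].
pose lo := [set k : 'I_d.+1 | (k <= i)%N].
pose hi := [set k : 'I_d.+1 | (0 < k <= i)%N].
have clo : #|lo| = #|hi|.+1.
  rewrite (cardsD1 ord0) inE leq0n add1n; congr (_.+1); apply: eq_card => k.
  by rewrite !inE lt0n.
have [j] : exists j, j \in s @: lo :\: pi @: hi.
  apply/set0Pn; rewrite setD_eq0; apply/negP => /subset_leq_card.
  by rewrite !card_imset ?clo ?ltnn //; apply: perm_inj.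
rewrite inE => /andP[jhi /imsetP[l llo jl]].
rewrite inE in llo; apply: (le_trans (sorted _ _ llo)).
rewrite -jl -[j](permKV pi) piE /Tbary ifN //.
by apply: contra jhi => H; apply/imsetP; exists ((pi^-1)%g j); rewrite ?inE ?permKV.
Qed.

(** * The extremal case: a lattice basis from the edges at the last vertex *)

Section Extremal.
Hypothesis betaE : forall c : 'I_d,
  beta (s (widen_ord (leqnSn d) c)) = (sylv c.+1)%:R^-1.

Let last_vertex : 'rV[int]_d := row (s ord_max) V.
Let edge (c : 'I_d) : 'rV[int]_d :=
  row (s (widen_ord (leqnSn d) c)) V - last_vertex.

Let sylvR0 (c : nat) : (sylv c.+1)%:R != 0 :> R.
Proof. by rewrite pnatr_eq0. Qed.

(** Multiply x - [last_vertex] = sum_l edge_l / s_(l+1) by the product of all s_(k+1): the left side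
    and every term other than [M c * edge c] become divisible by s_(c+1), and [M c] is coprime to
    s_(c+1). *)
Lemma sylv_dvd_edge (c j : 'I_d) : ((sylv c.+1)%:Z %| edge c 0%R j)%Z.
Proof.
have [z xz] := xint.
pose M (l : 'I_d) : int := \prod_(k < d | k != l) (sylv k.+1)%:Z.
have E : (\prod_(k < d) (sylv k.+1)%:Z) * (z - last_vertex) 0 j =
    \sum_l M l * edge l 0 j.
  have xE : (z 0 j)%:~R - (last_vertex 0 j)%:~R =
      \sum_(l < d) (sylv l.+1)%:R^-1 * (edge l 0 j)%:~R :> R.
    have -> : (z 0 j)%:~R = x 0 j by rewrite xz mxE.
    have -> : x 0 j - (last_vertex 0 j)%:~R =
        \sum_k beta (s k) * ((V (s k) j)%:~R - (last_vertex 0 j)%:~R).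
      under eq_bigr do rewrite mulrBr.
      have b1 := xb.1; rewrite (reindex_inj (@perm_inj _ s)) /= in b1.
      rewrite sumrB -mulr_suml b1 mul1r xb.2 summxE; congr (_ - _).
      by rewrite (reindex_inj (@perm_inj _ s)) /=; apply: eq_bigr => k _; rewrite !mxE.
    rewrite big_ord_recr /= [last_vertex 0 j]mxE subrr mulr0 addr0.
    apply: eq_bigr => l _; rewrite betaE; congr (_ * _).
    by rewrite -intrB !mxE.
  apply: (@intr_inj R).
  have -> : (z - last_vertex) 0 j = z 0 j - last_vertex 0 j by rewrite !mxE.
  rewrite intrM intrB xE.
  rewrite rmorph_sum /= mulr_sumr; apply: eq_bigr => l _.
  rewrite intrM mulrA; congr (_ * _).
  by rewrite (bigD1 l) //= intrM -/(M l) mulrC mulrA mulVf ?mul1r.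
have dM l : l != c -> ((sylv c.+1)%:Z %| M l)%Z.
  by move=> lc; rewrite /M (bigD1 c) 1?eq_sym //=; apply: dvdz_mulr.
have : ((sylv c.+1)%:Z %| (M c * edge c 0 j)%R)%Z.
  have -> : M c * edge c 0 j = (\prod_(k < d) (sylv k.+1)%:Z) * (z - last_vertex) 0 j
      - \sum_(l | l != c) M l * edge l 0 j by rewrite E (bigD1 c) //= addrK.
  rewrite rpredB //; first by rewrite (bigD1 c) //= -mulrA dvdz_mulr.
  by apply: rpred_sum => l lc; apply: dvdz_mulr; apply: dM.
rewrite Gauss_dvdzr // /M; apply: (big_ind (coprimez (sylv c.+1)%:Z)).
- by rewrite coprimezE coprimen1.
- by move=> u v cu cv; rewrite coprimezMr cu.
- move=> k kc; rewrite coprimezE; apply: coprime_sylv.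
  by rewrite eq_sym.
Qed.

Let F : 'M[int]_d := \matrix_(c, j) (edge c 0%R j %/ (sylv c.+1)%:Z)%Z.

Let edgeE c j : edge c 0 j = (sylv c.+1)%:Z * F c j.
Proof. by rewrite [F c j]mxE mulrC divzK ?sylv_dvd_edge. Qed.

(** Coordinates of [last_vertex] + a F: position c < d gets a_c / s_(c+1); [insub] fails only at
    position d, where the default completes the sum to 1. *)
Let frame_bary (a : 'rV[R]_d) (k : 'I_d.+1) : R :=
  oapp (fun c : 'I_d => a 0 c / (sylv c.+1)%:R)
    (1 - \sum_c a 0 c / (sylv c.+1)%:R) (insub (val ((s^-1)%g k))).

Let frame_bary_widen a c :
  frame_bary a (s (widen_ord (leqnSn d) c)) = a 0 c / (sylv c.+1)%:R.
Proof. by rewrite /frame_bary permK /= (valK c). Qed.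

Let frame_bary_max a :
  frame_bary a (s ord_max) = 1 - \sum_c a 0 c / (sylv c.+1)%:R.
Proof. by rewrite /frame_bary permK insubF //= ltnn. Qed.

Lemma is_bary_frame (a : 'rV[R]_d) :
  is_bary (rmx R V) (rmx R last_vertex + a *m rmx R F) (frame_bary a).
Proof.
have b1 : \sum_k frame_bary a k = 1.
  rewrite (reindex_inj (@perm_inj _ s)) big_ord_recr /= frame_bary_max.
  under eq_bigr do rewrite frame_bary_widen.
  by rewrite addrC subrK.
have edge_sum j :
    \sum_k frame_bary a k * ((V k j)%:~R - (last_vertex 0 j)%:~R) =
    \sum_c a 0 c * (F c j)%:~R.
  rewrite (reindex_inj (@perm_inj _ s)) big_ord_recr /=.
  rewrite [last_vertex 0 j]mxE subrr mulr0 addr0; apply: eq_bigr => c _.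
  have -> : (V (s (widen_ord (leqnSn d) c)) j)%:~R - (V (s ord_max) j)%:~R =
      (sylv c.+1)%:R * (F c j)%:~R :> R.
    by rewrite -intrB -[(sylv c.+1)%:R]/((sylv c.+1)%:Z%:~R) -intrM -edgeE !mxE.
  by rewrite frame_bary_widen mulrA divfK.
split=> //; apply/rowP => j.
have := edge_sum j; under eq_bigr do rewrite mulrBr.
rewrite sumrB -mulr_suml b1 mul1r => /eqP; rewrite subr_eq => /eqP E.
rewrite summxE; transitivity (\sum_k frame_bary a k * (V k j)%:~R).
  by rewrite E !mxE addrC; congr (_ + _); apply: eq_bigr => c _; rewrite !mxE.
by apply: eq_bigr => k _; rewrite !mxE.
Qed.

(** If a F = 0, then a and 0 give the same point, hence the same barycentric coordinates. *)
Lemma frame_unit : rmx R F \in unitmx.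
Proof.
rewrite -row_free_unit; apply: inj_row_free => a a0.
have := is_bary_frame a; rewrite a0 -(mul0mx _ (rmx R F)) => ba.
have E := is_bary_uniq _ _ _ _ _ _ Sd1.1 ba (is_bary_frame 0).
apply/rowP => c; have := E (s (widen_ord (leqnSn d) c)).
by rewrite !frame_bary_widen mul0mx => /(mulIf (invr_neq0 (sylvR0 c))).
Qed.

(* Reducing the frame coordinates of an integral point modulo 1 into ]0, 1]
   gives an interior point of the simplex, hence x itself, whose frame
   coordinates are all 1. *)
Lemma frame_coord_integral (z : 'rV[int]_d) :
  intpt ((rmx R z - rmx R last_vertex) *m invmx (rmx R F)).
Proof.
have Fu := frame_unit.
have rF : rmx R F = map_mx intr F by [].
have det0 : (\det F)%:~R != 0 :> R.
  by rewrite -unitfE -[_%:~R](det_map_mx intr) -unitmxE.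
set a := (X in intpt X).
(* Cramer's rule over the positive denominator (det F)^2. *)
pose h : 'rV[int]_d := \det F *: ((z - last_vertex) *m \adj F).
pose N : int := \det F ^+ 2.
have Nn : N != 0 by rewrite expf_neq0 //; apply: contraNneq det0 => ->.
have N0 : 0 < N by rewrite lt_def Nn sqr_ge0.
have NR : 0 < N%:~R :> R by rewrite ltr0z.
have aE c : a 0 c = (h 0 c)%:~R / N%:~R.
  rewrite /a /invmx Fu -scalemxAr rF det_map_mx -map_mx_adj.
  have -> : rmx R z - rmx R last_vertex = map_mx intr (z - last_vertex).
    by rewrite raddfB.
  rewrite -map_mxM [LHS]mxE [X in _ * X]mxE [h 0 c]mxE intrM /N rmorphXn /=.
  by field.
(* Dividing h - 1 instead of h puts the remainder [e] in 1..N rather than 0..N-1, so no coordinate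
   vanishes. *)
pose t : 'rV[int]_d := \row_c ((h 0%R c - 1)%R %/ N)%Z.
pose e c : int := ((h 0%R c - 1)%R %% N)%Z + 1.
have hE c : h 0 c = t 0 c * N + e c.
  by rewrite [t 0 c]mxE /e addrA -divz_eq subrK.
have e0 c : 0 < e c by rewrite /e ltzD1 modz_ge0.
have eN c : e c <= N by rewrite /e lezD1 ltz_pmod.
pose a' := a - rmx R t.
have subE (u : 'rV[R]_d) (v : 'rV[int]_d) c :
    (u - rmx R v) 0 c = u 0 c - (v 0 c)%:~R by rewrite !mxE.
have a'E c : a' 0 c = (e c)%:~R / N%:~R.
  rewrite /a' subE aE hE intrD intrM.
  by field; rewrite gt_eqF.
have zE : rmx R last_vertex + a' *m rmx R F = rmx R (z - t *m F).
  have -> : rmx R (z - t *m F) = rmx R z - rmx R t *m rmx R F.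
    by rewrite {1}/rmx raddfB /= map_mxM.
  by rewrite mulmxBl mulmxKV // addrA [_ + (_ - _)]addrC subrK.
have bE : frame_bary a' =1 beta.
  apply: (interior_bary_uniq R d V x beta Sd1 xint xin xb (rmx R (z - t *m F))).
  - by exists (z - t *m F).
  - by rewrite -zE; apply: is_bary_frame.
  have a'0 c : 0 < a' 0 c by rewrite a'E divr_gt0 ?ltr0z.
  have a'1 c : a' 0 c <= 1 by rewrite a'E ler_pdivrMr // mul1r ler_int.
  move=> k; rewrite -[k](permKV s); case: (unliftP ord_max ((s^-1)%g k)) => [c ->|->].
    have -> : lift ord_max c = widen_ord (leqnSn d) c.
      by apply: val_inj; rewrite /= /bump leqNgt ltn_ord.
    by rewrite frame_bary_widen divr_gt0.
  (* The last coordinate stays positive because the Sylvester reciprocals sum to less than 1. *)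
  rewrite frame_bary_max subr_gt0.
  apply: (@le_lt_trans _ _ (\sum_(c < d) (sylv c.+1)%:R^-1)).
    by apply: ler_sum => c _; rewrite ler_piMl ?invr_ge0 ?ler0n.
  by rewrite sum_sylvV gtrBl invr_gt0 ltr0n sylvprod_gt0.
exists (t + const_mx 1); apply/rowP => c.
have := bE (s (widen_ord (leqnSn d) c)); rewrite frame_bary_widen betaE => E.
have {}E : a' 0 c = 1 by rewrite -[LHS](divfK (sylvR0 c)) E mulVf.
move: E; rewrite /a' subE => /eqP; rewrite subr_eq addrC => /eqP ->.
by move: t {a' a'E zE bE hE} => t; rewrite !mxE intrD.
Qed.

(** The map y -> (y - [last_vertex]) F^-1 sends [edge c] to s_(c+1) e_(c+1), and it preserves the
    lattice because F and all frame coordinates of integral points are integral. *)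
Lemma equiv_Tmat_max : unimod_equiv (conv (rmx R V)) (conv (rmx R (Tmat d d.+1))).
Proof.
have Fu := frame_unit.
have rF : rmx R F = map_mx intr F by [].
exists (invmx (rmx R F)), (- (rmx R last_vertex *m invmx (rmx R F))).
split; first by rewrite unitmx_inv.
split=> [y|].
  split=> [[w ->]|[_ [z ->] <-]]; last by rewrite -mulmxBl; apply: frame_coord_integral.
  exists (rmx R (w *m F + last_vertex)); first by exists (w *m F + last_vertex).
  rewrite -mulmxBl {1}/rmx raddfD /= addrK map_mxM -rF mulmxK //.
(* A cyclic shift: T lists the origin first, while its counterpart [last_vertex] is in the last
   position. *)
pose rho k := s (ord_pred k).
have rho_inj : injective rho by move=> k l /perm_inj/ord_pred_inj.
apply: (conv_affine_image _ _ _ _ _ _ (perm rho_inj)) => k.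
rewrite permE -mulmxBl; apply: (can_inj (mulmxK Fu)); rewrite mulmxKV //.
case: (unliftP ord0 k) => [c ->|->].
  have -> : rho (lift ord0 c) = s (widen_ord (leqnSn d) c).
    congr (s _); apply: val_inj; rewrite /= add0n.
    by rewrite modnDr modn_small // ltnS ltnW.
  apply/rowP => j.
  transitivity ((edge c 0 j)%:~R : R); first by rewrite !mxE intrB.
  rewrite edgeE intrM !mxE (bigD1 c) //= !mxE eqxx /Tcoef /= ltnS ltn_ord.
  by rewrite big1 ?addr0 // => l lc; rewrite !mxE ifN ?mul0r // eqSS eq_sym.
have -> : rho ord0 = s ord_max.
  by congr (s _); apply: val_inj; rewrite /= modn_small.
apply/rowP => j; rewrite !mxE subrr big1 // => l _.
by rewrite !mxE mul0r.
Qed.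

End Extremal.
End Equivalence.

(* i : 'I_d.+1 encodes the paper's index i+1 in {1,...,d+1}; the sorted
   coordinates are beta_(i+1) = beta (s i), s a sorting permutation. *)
Theorem mainTheorem1 (R : realFieldType) (d : nat) (V : 'M[int]_(d.+1, d))
    (i : 'I_d.+1) (x : 'rV[R]_d) (beta : 'I_d.+1 -> R) (s : 'S_d.+1) :
  in_Sd1 R V ->
  intpt x -> interior (conv (rmx R V)) x ->
  is_bary (rmx R V) x beta ->
  (forall j k : 'I_d.+1, (j <= k)%N -> beta (s k) <= beta (s j)) ->
  let m : R := (((d.+1 - i) * (sylv i.+1 - 1))%N%:R)^-1 in
  [/\ m <= beta (s i),
      unimod_equiv (conv (rmx R V)) (conv (rmx R (Tmat d i.+1))) ->
        beta (s i) = m,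
      beta (s i) = m <->
        (forall j : 'I_d.+1,
           beta (s j) = if (j < i)%N then ((sylv j.+1)%:R)^-1 else m)
    & i = ord_max ->
        (beta (s i) = m <->
         unimod_equiv (conv (rmx R V)) (conv (rmx R (Tmat d d.+1))))].
Proof.
move=> Sd1 xint xin xb srt m.
have [le eq] := sorted_bary_bound R d V x beta Sd1 xint xin xb s srt i.
have equiv_eq : unimod_equiv (conv (rmx R V)) (conv (rmx R (Tmat d i.+1))) ->
    beta (s i) = m.
  move=> eqv; apply: le_anti; rewrite le andbT.
  exact: (equiv_Tmat_le R d V x beta s Sd1 xint xin xb srt).
split=> //; first by split=> [|->]; rewrite ?ltnn.
move=> imax; split=> [E|]; last by move: equiv_eq; rewrite imax.
apply: (equiv_Tmat_max R d V x beta s Sd1 xint xin xb) => c.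
by rewrite eq // imax /= ltn_ord.
Qed.
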